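(* Let $\tau:[0,\infty)\to[0,\infty)$ be continuous with $\lim_{t\to\infty}\{t-\tau(t)\}=\infty$, and let $-\bar{\tau}=\inf_{t\ge 0}\{t-\tau(t)\}$. Let $\sigma:[-\bar\tau,\infty)\to[0,\infty)$ be continuous and such that $$\lim_{t\to\infty}\int_0^t\frac{1}{\sigma(s)}\,ds=\infty,\quad \lim_{t\to\infty}\sigma(t)=\infty,\quad \lim_{t\to\infty}\int_{t-\tau(t)}^t\frac{1}{\sigma(s)}\,ds=1,\quad \lim_{t\to\infty}\frac{\sigma(t)}{t}=\infty.$$ Let $a>b>0$ and let $g:[0,\infty)\to[0,\infty)$ be continuous with $g(0)=0$, $g(x)>0$ for $x>0$, such that there is $\delta_1>0$ with $g\in C^1(0,\delta_1)$ and $g'(x)>0$ for $x\in(0,\delta_1)$, and there is $\beta>1$ with $g'\in\mathrm{RV}_0(\beta-1)$. Let $\psi\in C([-\bar\tau,0];(0,\infty))$. If the solution $x$ of $$x'(t)=-ag(x(t))+bg(x(t-\tau(t))),\quad t\ge 0;\qquad x(t)=\psi(t),\quad t\in[-\bar\tau,0],$$ obeys $x(t)\to0$ as $t\to\infty$, then $$\lim_{t\to\infty}\frac{\log g(x(t))}{\int_0^t\frac{1}{\sigma(s)}\,ds}=-\log\left(\frac ab\right).$$ Moreover, this limit is equivalent to $$\lim_{t\to\infty}\frac{\log x(t)}{\int_0^t\frac{1}{\sigma(s)}\,ds}=-\frac1\beta\log\left(\frac ab\right)$$ (so both limits hold).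
   Context: A function $f$, positive near $0$ on the right, is regularly varying at zero with exponent $\alpha\in\mathbb{R}$, written $f\in\mathrm{RV}_0(\alpha)$, if $\lim_{t\to0^+}f(\lambda t)/f(t)=\lambda^\alpha$ for all $\lambda>0$. A solution of the delay equation is a continuous function $x:[-\bar\tau,\infty)\to(0,\infty)$, differentiable on $[0,\infty)$ (one-sided at $0$), satisfying the equation for all $t\ge0$ and equal to $\psi$ on $[-\bar\tau,0]$; solutions are positive. The integrals of $1/\sigma$ over compact intervals are understood to be finite. *)

(* Defs.v *)
From HB Require Import structures.
From mathcomp Require Import all_boot all_order all_algebra.
From mathcomp Require Import all_classical all_reals all_analysis.

Set Implicit Arguments.
Unset Strict Implicit.
Unset Printing Implicit Defensive.

Import Order.TTheory GRing.Theory Num.Theory.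
Import numFieldNormedType.Exports.

Local Open Scope classical_set_scope.
Local Open Scope ring_scope.

(* Functions whose mathematical domain is a half-line or an interval are total
   functions [R -> R]; every hypothesis constrains them on that domain only. *)

(* Bounded below when [tau] is continuous and [t - tau t] tends to infinity, so
   that [inf] is then the genuine infimum. *)
Definition taubar (R : realType) (tau : R -> R) : R :=
  - inf [set t - tau t | t in [set t : R | 0 <= t]].

(* The inverse is taken in [\bar R], where [0^-1 = +oo]: the zeros of [sigma]
   are not ignored, unlike what would happen with the inverse of [R]. *)
Definition inv_fun (R : realType) (sigma : R -> R) (s : R) : \bar R :=
  ((sigma s)%:E^-1)%E.

(* Real-valued; meaningful where [inv_fun sigma] is integrable on [u, v]. *)
Definition int_inv (R : realType) (sigma : R -> R) (u v : R) : R :=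
  fine (\int[lebesgue_measure]_(s in `[u, v]) inv_fun sigma s)%E.

Definition RV0 (R : realType) (alpha : R) (f : R -> R) : Prop :=
  (\forall t \near 0^'+, 0 < f t) /\
  (forall lambda : R, 0 < lambda ->
     f (lambda * t) / f t @[t --> 0^'+] --> lambda `^ alpha).

Definition is_right_derive (R : realType) (t : R) (f : R -> R) (l : R) : Prop :=
  (f (t + h) - f t) / h @[h --> 0^'+] --> l.

Definition delay_rhs (R : realType) (a b : R) (g tau x : R -> R) (t : R) : R :=
  - a * g (x t) + b * g (x (t - tau t)).

Definition delay_solution (R : realType) (a b : R) (g tau psi x : R -> R)
    : Prop :=
  [/\ {within `[- taubar tau, +oo[, continuous x},
      (forall t : R, - taubar tau <= t -> 0 < x t),
      is_right_derive 0 x (delay_rhs a b g tau x 0),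
      (forall t : R, 0 < t -> is_derive t 1 x (delay_rhs a b g tau x t)) &
      (forall t : R, - taubar tau <= t <= 0 -> x t = psi t)].

(* Main.v *)
Require Import Defs.
From HB Require Import structures.
From mathcomp Require Import all_boot all_order all_algebra.
From mathcomp Require Import all_classical all_reals all_analysis.
From mathcomp Require Import ring lra.
Set Implicit Arguments.
Unset Strict Implicit.
Unset Printing Implicit Defensive.
Import Order.TTheory GRing.Theory Num.Theory.
Import numFieldNormedType.Exports.
Local Open Scope classical_set_scope.
Local Open Scope ring_scope.

(** Put [u t = g (x t)] and [S t = int_inv sigma 0 t]. The equation becomes
    [u' t = g' (x t) * (- a * u t + b * u (t - tau t))], while the clock [S]
    advances by asymptotically one unit over each delay and runs so slowly
    ([sigma t / t] tends to infinity) that [S] is negligible against [ln t].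
    In such slow time the equation is quasi-static: the bracket nearly
    vanishes, so [u] is divided by about [a / b] during each unit of the clock,
    and [ln u] behaves like [- ln (a / b) * S].

    To make this rigorous, the exponentials [expR (- mu * S)] serve as
    supersolutions for [mu < ln (a / b)] and as subsolutions for
    [mu > ln (a / b)] ([log_delay_decay]); the comparison is a Razumikhin
    argument at the first crossing ([razumikhin_bounded]). The supersolution
    property requires [sigma * g' (x)] to be large whenever [u] has the size of
    [expR (- mu * S)]. Regular variation enters through its logarithmic
    consequence only, [ln (f t) / ln t] tends to the exponent ([RV0_ln_cvg]):
    as [g'] has exponent [beta - 1] and [g] has exponent [beta]
    ([RV0_primitive]), it gives [g <= g'] near zero ([RV0_lt]), so
    [sigma * g' (x)] dominates [sigma * expR (- mu * S)], which tends to
    infinity by the slowness of the clock ([expR_slow_clock_gt]).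

    The limit for [ln x] follows from the one for [ln (g x)] because
    [ln (g (x t)) / ln (x t)] tends to [beta]. *)

(** * Logarithmic order of regularly varying functions *)

Lemma cvg_near_eq (T : Type) (U : topologicalType) (F : set_system T)
    {FF : Filter F} (f h : T -> U) (l : U) :
  (\forall t \near F, h t = f t) -> h @ F --> l -> f @ F --> l.
Proof. by move=> hf; apply: cvg_trans; apply: near_eq_cvg. Qed.

(** Finitely many doublings bring every small [t > 0] into the fundamental
    interval between [d / 2] and [d], and doubling can only increase [l]. *)
Lemma halving_bound (R : realType) (l : R -> R) (d M : R) :
    (forall t, 0 < t <= d -> l (2^-1 * t) <= l t) ->
    (forall t, 2^-1 * d < t <= d -> l t <= M) ->
  forall t, 0 < t <= d -> l t <= M.
Proof.
move=> lhalf lM.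
have bound n : forall t, 0 < t <= d -> d < 2 ^+ n * t -> l t <= M.
  elim: n => [t /andP[_ td]|n IHn t /andP[t0 td] dt].
    by rewrite expr0 mul1r ltNge td.
  have [dt2|td2] := ltP (2^-1 * d) t; first by rewrite lM // dt2.
  have t2d : 2 * t <= d by lra.
  have := lhalf (2 * t); rewrite mulKf// => /(_ _)/le_trans; apply.
    by rewrite t2d andbT; lra.
  by apply: IHn; [rewrite t2d andbT; lra | rewrite mulrA -exprSr].
move=> t /[dup] td /andP[t0 _]; apply: (bound (Num.bound (d / t))) => //.
rewrite -ltr_pdivrMr//; apply: (lt_trans (archi_boundP _)).
  by rewrite divr_ge0// ltW// (lt_le_trans t0)//; case/andP: td.
by rewrite -natrX ltr_nat ltn_expl.
Qed.

(** The correction [eps * ln t] turns the small increments of [l] under halving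
    into negative ones, so that a bound on one fundamental interval, which
    continuity provides, is inherited by all smaller [t]. *)
Lemma slowly_varying_le (R : realType) (l : R -> R) (delta eps : R) :
    0 < delta -> 0 < eps ->
    {in `]0, delta[, continuous l} ->
    l (2^-1 * t) - l t @[t --> 0^'+] --> 0 ->
  exists C, \forall t \near 0^'+, l t <= C - eps * ln t.
Proof.
move=> delta0 eps0 lcont lslow.
pose h t := l t + eps * ln t.
have ln2 : 0 < eps * ln (2 : R) by rewrite mulr_gt0// ln_gt0// ltr1n.
have [d d0 hd] : exists2 d, 0 < d &
    forall t, 0 < t <= d -> t < delta /\ l (2^-1 * t) - l t < eps * ln 2.
  have : \forall t \near 0^'+, t < delta /\ l (2^-1 * t) - l t < eps * ln 2.
    near=> t; split; near: t; first exact: nbhs_right_lt.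
    exact: (cvgr_lt _ lslow).
  case=> e /= e0 he; exists (2^-1 * e) => [|t /andP[t0 te]]; first by lra.
  by apply: he => //=; rewrite sub0r normrN gtr0_norm//; lra.
have [c _ hc] : exists2 c, c \in `[2^-1 * d, d] &
    forall t, t \in `[2^-1 * d, d] -> h t <= h c.
  apply: EVT_max; first by lra.
  apply: continuous_in_subspaceT => t; rewrite inE/= in_itv/= => /andP[dt td].
  have t0 : 0 < t by lra.
  apply: cvgD.
    by apply: lcont; rewrite in_itv/= t0 (hd t _).1// t0.
  by apply: cvgM; [exact: cvg_cst | exact: continuous_ln].
exists (h c); near=> t; rewrite lerBrDr.
apply: (@halving_bound _ h d).
- move=> s /[dup] sd /andP[s0 _]; have [_] := hd s sd.
  rewrite /h lnM ?posrE// lnV ?posrE//; lra.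
- by move=> s /andP[ds sd]; apply: hc; rewrite in_itv/= sd ltW.
- by apply/andP; split; near: t; [exact: nbhs_right_gt | exact: nbhs_right_le].
Unshelve. all: by end_near. Qed.

(** Both [l] and [- l] are at most [C - eps * ln t] with [eps] arbitrary, while
    [- ln t] tends to infinity. *)
Lemma slowly_varying_ln_cvg (R : realType) (l : R -> R) (delta : R) :
    0 < delta -> {in `]0, delta[, continuous l} ->
    l (2^-1 * t) - l t @[t --> 0^'+] --> 0 ->
  l t / ln t @[t --> 0^'+] --> 0.
Proof.
move=> delta0 lcont lslow; apply/cvgrPdist_le => eps eps0.
have e20 : 0 < eps / 2 by lra.
have [C1 HC1] := slowly_varying_le delta0 e20 lcont lslow.
have ncont : {in `]0, delta[, continuous (fun t => - l t)}.
  by move=> t /lcont; exact: cvgN.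
have nslow : - l (2^-1 * t) - - l t @[t --> 0^'+] --> 0.
  under eq_fun do rewrite -opprD.
  by have := cvgN lslow; rewrite oppr0; apply.
have [C2 HC2] := slowly_varying_le delta0 e20 ncont nslow.
have /cvgrNyPle lnNy := @lnNy R.
near=> t.
have lnt0 : ln t < 0.
  by apply: (@le_lt_trans _ _ (-1)); [near: t; exact: lnNy | lra].
rewrite sub0r normrN normrM normfV [`|ln t|]ltr0_norm// ler_pdivrMr ?oppr_gt0//.
have : l t <= C1 - eps / 2 * ln t by near: t.
have : - l t <= C2 - eps / 2 * ln t by near: t.
have : ln t <= - (`|C1| + `|C2|) / (eps / 2) by near: t; exact: lnNy.
rewrite ler_pdivlMr// => lnt H2 H1.
have := ler_norm C1; have := ler_norm C2.
have := normr_ge0 C1; have := normr_ge0 C2.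
by move=> ? ? ? ?; rewrite ler_norml; apply/andP; split; lra.
Unshelve. all: by end_near. Qed.

(** Applied to [l = ln f - alpha * ln], whose increments under halving tend to
    zero precisely because [f (t / 2) / f t] tends to [2 ^ - alpha]. *)
Lemma RV0_ln_cvg (R : realType) (alpha : R) (f : R -> R) (delta : R) :
    0 < delta -> {in `]0, delta[, continuous f} -> RV0 alpha f ->
  ln (f t) / ln t @[t --> 0^'+] --> alpha.
Proof.
move=> delta0 fcont [fpos f2].
have [d d0 hd] : exists2 d, 0 < d & forall t, 0 < t < d -> t < delta /\ 0 < f t.
  have : \forall t \near 0^'+, t < delta /\ 0 < f t.
    by near=> t; split; near: t => //; exact: nbhs_right_lt.
  case=> d /= d0 hd; exists d => // t /andP[t0 td].
  by apply: hd => //=; rewrite sub0r normrN gtr0_norm.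
pose l t := ln (f t) - alpha * ln t.
have lcont : {in `]0, d[, continuous l}.
  move=> t; rewrite in_itv/= => td; have [tdelta ft] := hd t td.
  have t0 : 0 < t by case/andP: td.
  apply: cvgB.
    apply: continuous_comp; last exact: continuous_ln.
    by apply: fcont; rewrite in_itv/= t0.
  by apply: cvgM; [exact: cvg_cst | exact: continuous_ln].
have lslow : l (2^-1 * t) - l t @[t --> 0^'+] --> 0.
  have lim1 : ln (f (2^-1 * t) / f t) @[t --> 0^'+] --> alpha * ln 2^-1.
    rewrite -ln_powR; apply: continuous_cvg; last exact: f2.
    by apply: continuous_ln; rewrite powR_gt0.
  have := cvgB lim1 (cvg_cst (alpha * ln 2^-1)); rewrite subrr => lim0.
  apply: cvg_near_eq (lim0 _ _); near=> t.
  have t0 : 0 < t by near: t; exact: nbhs_right_gt.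
  have td : t < d by near: t; exact: nbhs_right_lt.
  have [_ ft] : t < delta /\ 0 < f t by apply: hd; rewrite t0.
  have [_ ft2] : 2^-1 * t < delta /\ 0 < f (2^-1 * t).
    by apply: hd; apply/andP; split; lra.
  rewrite /l !fctE ln_div ?posrE// lnM ?posrE//; ring.
have llim := slowly_varying_ln_cvg d0 lcont lslow.
have := cvgD llim (cvg_cst alpha); rewrite add0r => lim.
apply: cvg_near_eq (lim _ _); near=> t.
have lnt : ln t != 0.
  rewrite lt_eqF// ln_lt0//; apply/andP; split; near: t.
    exact: nbhs_right_gt.
  exact: nbhs_right_lt.
by rewrite /l !fctE mulrBl mulfK// subrK.
Unshelve. all: by end_near. Qed.

Lemma cvg_right0 (R : realType) (T : Type) (F : set_system T) {FF : Filter F}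
    (f : T -> R) :
  f @ F --> 0 -> (\forall t \near F, 0 < f t) -> f @ F --> 0^'+.
Proof. by move=> f0 fpos P /f0; apply: filterS2 fpos => t ft0; apply. Qed.

(** Karamata's theorem for primitives, here an instance of l'Hopital's rule:
    the quotient of the derivatives of [g (k * y)] and [g y] is
    [k * g' (k * y) / g' y], which tends to [k * k ^ (beta - 1)]. *)
Lemma RV0_primitive (R : realType) (beta delta : R) (g : R -> R) :
    0 < delta -> g t @[t --> 0^'+] --> 0 -> (forall y, 0 < y -> 0 < g y) ->
    {in `]0, delta[, forall y, derivable g y 1} ->
    {in `]0, delta[, forall y, 0 < derive1 g y} ->
    RV0 (beta - 1) (derive1 g) ->
  RV0 beta g.
Proof.
move=> delta0 g0 gpos gder dgpos [_ dgRV].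
split=> [|k k0]; first by near=> t; apply: gpos; near: t; exact: nbhs_right_gt.
(* Both [y] and [k * y] stay below [delta] for [y < d]. *)
pose d := Num.min delta (delta / k).
have d0 : 0 < d by rewrite lt_min delta0 divr_gt0.
have dP (y : R) : y \in `]0, d[ -> (y \in `]0, delta[) /\ k * y \in `]0, delta[.
  rewrite !in_itv/= lt_min => /and3P[y0 -> yk].
  by rewrite y0 mulr_gt0//= mulrC -ltr_pdivlMr.
have k_is (y : R) : is_derive y 1 (fun y => k * y) k.
  by apply: is_derive_eq; rewrite /GRing.scale/= mulr1.
have gk_is (y : R) : y \in `]0, d[ ->
    is_derive y 1 (fun y => g (k * y)) (k * derive1 g (k * y)).
  move=> /dP[_ /gder gky].
  have gky' : is_derive (k * y) 1 g (derive1 g (k * y)).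
    by apply: DeriveDef => //; rewrite derive1E.
  rewrite mulrC; exact: (@is_derive1_comp _ g (fun y => k * y)).
have g_is (y : R) : y \in `]0, d[ -> is_derive y 1 g (derive1 g y).
  by move=> /dP[/gder gy _]; apply: DeriveDef => //; rewrite derive1E.
have gk0 : g (k * y) @[y --> 0^'+] --> 0.
  apply: cvg_comp g0; apply: cvg_right0.
    have := cvgM (cvg_cst k) (@cvg_at_right_filter _ _ id 0 _ cvg_id).
    by rewrite mulr0; apply.
  by near=> y; rewrite mulr_gt0//; near: y; exact: nbhs_right_gt.
apply: (lhopital_at_right d0 gk_is g_is gk0 g0).
  by move=> y /dP[/dgpos dgy _]; rewrite gt_eqF.
have -> : k `^ beta = k * k `^ (beta - 1).
  rewrite -{2}[k]powRr1 ?ltW// -powRD; last by rewrite (gt_eqF k0) implybT.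
  by rewrite subrKC.
under eq_fun do rewrite -mulrA.
exact: (cvgM (cvg_cst k) (dgRV k k0)).
Unshelve. all: by end_near. Qed.

(** Dividing [ln] of a function by [ln y < 0] reverses order, so near zero the
    smaller exponent gives the larger function. Applied to [g] and [g'], this
    bounds [g' (x t)] below by [g (x t)] along a solution. *)
Lemma RV0_lt (R : realType) (alpha1 alpha2 delta : R) (f h : R -> R) :
    alpha1 < alpha2 -> 0 < delta ->
    {in `]0, delta[, continuous f} -> {in `]0, delta[, continuous h} ->
    RV0 alpha1 f -> RV0 alpha2 h ->
  \forall y \near 0^'+, h y < f y.
Proof.
move=> a12 delta0 fcont hcont fRV hRV.
have flim := RV0_ln_cvg delta0 fcont fRV.
have hlim := RV0_ln_cvg delta0 hcont hRV.
pose c := (alpha1 + alpha2) / 2.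
near=> y.
have f0 : 0 < f y by near: y; case: fRV.
have h0 : 0 < h y by near: y; case: hRV.
have lny0 : ln y < 0.
  rewrite ln_lt0//; apply/andP; split; near: y; first exact: nbhs_right_gt.
  exact: nbhs_right_lt.
have fc : ln (f y) / ln y < c.
  by near: y; apply: (cvgr_lt _ flim); rewrite /c; lra.
have hc : c < ln (h y) / ln y.
  by near: y; apply: (cvgr_gt _ hlim); rewrite /c; lra.
rewrite -ltr_ln ?posrE//.
rewrite ltr_ndivrMr// in fc; rewrite ltr_ndivlMr// in hc.
exact: lt_trans hc fc.
Unshelve. all: by end_near. Qed.

(** * The clock: the integral of 1 / sigma *)

Lemma int_inv_cat (R : realType) (sigma : R -> R) (m u v w : R) :
    (forall u v, m <= u -> u <= v ->
       lebesgue_measure.-integrable `[u, v] (inv_fun sigma)) ->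
    m <= u -> u <= v -> v <= w ->
  int_inv sigma u w = int_inv sigma u v + int_inv sigma v w.
Proof.
move=> sint mu uv vw; rewrite /int_inv.
have mv := le_trans mu uv; have uw := le_trans uv vw.
have fin_int a b : m <= a -> a <= b ->
    (\int[lebesgue_measure]_(s in `[a, b]) inv_fun sigma s)%E \is a fin_num.
  by move=> ma ab; apply: integrable_fin_num => //; exact: sint.
rewrite -fineD ?fin_int//; congr fine.
have sub_int A : measurable A -> A `<=` `[u, w] ->
    lebesgue_measure.-integrable A (inv_fun sigma).
  by move=> mA Auw; apply: integrableS (sint _ _ mu uw).
rewrite (@itv_bndbnd_setU _ _ _ (BRight v)) ?bnd_simp//.
rewrite integral_setU/=; last 4 first.
- by [].
- by [].
- rewrite -itv_bndbnd_setU ?bnd_simp//.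
  exact: measurable_int (sint _ _ mu uw).
- apply/disj_setPS => y [/=]; rewrite 2!in_itv/= => /andP[_ yv] /andP[].
  by rewrite ltNge yv.
rewrite integral_itv_obnd_cbnd//; apply: measurable_int (sub_int _ _ _) => //.
exact: subset_itvr.
Qed.

(** The zeros of [sigma] lie before [T], where they only affect the constant
    [int_inv sigma 0 T]; from [T] on, the fundamental theorem of calculus
    applies to the real function [1 / sigma]. *)
Lemma is_derive_int_inv (R : realType) (sigma : R -> R) (m T : R) :
    (forall u v, m <= u -> u <= v ->
       lebesgue_measure.-integrable `[u, v] (inv_fun sigma)) ->
    m <= 0 -> 0 <= T ->
    (forall t, T <= t -> 0 < sigma t) ->
    (forall t, T < t -> {for t, continuous sigma}) ->
  forall t, T < t -> is_derive t 1 (int_inv sigma 0) (sigma t)^-1.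
Proof.
move=> sint m0 T0 spos scont t Tt.
have mT := le_trans m0 T0.
have sE s : T <= s -> inv_fun sigma s = ((sigma s)^-1)%:E.
  by move=> /spos s0; rewrite /inv_fun inver gt_eqF.
have fE v : \int[lebesgue_measure]_(s in `[T, v]) (sigma s)^-1 =
    int_inv sigma T v.
  rewrite /Rintegral /int_inv; congr fine; apply: eq_integral => s.
  by rewrite inE/= in_itv/= => /andP[Ts _]; rewrite sE.
pose F v := \int[lebesgue_measure]_(s in `[T, v]) (sigma s)^-1.
have [Fder F'] : derivable F t 1 /\ derive1 F t = (sigma t)^-1.
  apply: (@continuous_FTC1_closed _ _ T t (t + 1)) => //.
  - by lra.
  - apply: eq_integrable (sint T (t + 1) mT _) => //; last by lra.
    by move=> s; rewrite inE/= in_itv/= => /andP[Ts _]; rewrite sE.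
  - by apply: cvgV; [rewrite gt_eqF// spos// ltW | exact: scont].
have Fis : is_derive t 1 (fun v => int_inv sigma 0 T + F v) (sigma t)^-1.
  rewrite -[X in is_derive _ _ _ X]add0r; apply: is_deriveD.
  by apply: DeriveDef => //; rewrite derive1E in F'.
apply: (near_eq_is_derive _ Fis) => //.
near=> v; rewrite /F fE -(@int_inv_cat _ _ m)//.
by apply: ltW; near: v; exact: lt_nbhsr.
Unshelve. all: by end_near. Qed.

(** * A Razumikhin principle *)

Lemma near_pinfty_ge (R : realType) (P : set R) :
  (\forall t \near +oo, P t) -> \forall T \near +oo, forall t, T <= t -> P t.
Proof.
move=> [M [Mreal MP]]; exists M; split=> // T MT t Tt.
by apply: MP; exact: lt_le_trans Tt.
Qed.

Lemma left_max_derive1_ge0 (R : realType) (w : R -> R) (r t : R) :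
    r < t -> derivable w t 1 -> (forall s, r < s < t -> w s <= w t) ->
  0 <= derive1 w t.
Proof.
move=> rt wt wle; rewrite derive1E.
have : h^-1 *: (w (h *: 1 + t) - w t) @[h --> 0^'-] --> 'D_1 w t.
  apply: cvg_trans wt; apply: cvg_app.
  by apply: within_subset => h /= /lt_eqF->.
move=> /cvgr_to_ge; apply.
near=> h.
have h0 : h < 0 by near: h; exact: nbhs_left_lt.
have hr : r - t < h by near: h; apply: nbhs_left_gt; rewrite subr_lt0.
rewrite /GRing.scale/= mulr1 mulr_le0 ?invr_le0 ?(ltW h0)// subr_le0.
by apply: wle; apply/andP; split; lra.
Unshelve. all: by end_near. Qed.

(** At the first time that [w] reaches a high level [C], its value one delay
    earlier is at most [C], so the hypothesis forces [w] to be decreasing there;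
    but a first arrival from below needs a nonnegative derivative. *)
Lemma razumikhin_bounded (R : realType) (w tau : R -> R) (c0 : R) :
    (\forall t \near +oo, derivable w t 1) ->
    (\forall t \near +oo, 0 <= tau t) -> t - tau t @[t --> +oo] --> +oo ->
    (\forall t \near +oo, c0 <= w t -> w (t - tau t) <= w t ->
       derive1 w t < 0) ->
  exists C, \forall t \near +oo, w t <= C.
Proof.
move=> wder tau0 tauoo wdecr.
near (pinfty_nbhs R) => T.
have Tder t : T <= t -> derivable w t 1.
  by move: t; near: T; exact: near_pinfty_ge.
have Tdecr t : T <= t -> c0 <= w t -> w (t - tau t) <= w t ->
    derive1 w t < 0.
  by move: t; near: T; exact: near_pinfty_ge.
have Ttau t : T <= t -> 0 <= tau t.
  by move: t; near: T; exact: near_pinfty_ge.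
have wcont t : T <= t -> {for t, continuous w}.
  by move=> /Tder/derivable1_diffP/differentiable_continuous.
near (pinfty_nbhs R) => T2.
have TT2 : T <= T2 by near: T2; exact: nbhs_pinfty_ge.
have T2tau t : T2 <= t -> T <= t - tau t.
  move: t; near: T2; apply: near_pinfty_ge.
  by move/cvgryPge : tauoo; exact.
have [c _ wc] : exists2 c, c \in `[T, T2] &
    forall t, t \in `[T, T2] -> w t <= w c.
  apply: EVT_max => //; apply: continuous_in_subspaceT => t.
  by rewrite inE/= in_itv/= => /andP[/wcont].
(* Above [w] on the initial stretch, so that the crossing occurs after [T2],
   where the delayed argument stays above [T]. *)
pose C := Num.max c0 (w c + 1).
exists C; near=> t; rewrite leNgt; apply/negP => Cwt.
have Tt : T <= t by near: t; exact: nbhs_pinfty_ge.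
pose A := [set s | T <= s /\ C <= w s].
have At : A t by split; last exact: ltW.
have AT : lbound A T by move=> s [].
have Alb : has_inf A by split; [exists t | exists T].
pose s := inf A.
have Ts : T <= s by apply: lb_le_inf => //; exists t.
have ltC r : T <= r -> r < s -> w r < C.
  move=> Tr rs; rewrite ltNge; apply/negP => Cr.
  by have := ge_inf Alb.2 (conj Tr Cr : A r); rewrite leNgt rs.
have Cs : C <= w s.
  rewrite leNgt; apply/negP => wsC.
  have [e /= e0 he] : \forall r \near s, w r < C.
    exact: (cvgr_lt _ (wcont s Ts)).
  have [r [Tr Cr] rs] := inf_adherent e0 Alb.
  have : w r < C.
    have : s <= r := ge_inf Alb.2 (conj Tr Cr : A r).
    by move=> sr; apply: he => /=; rewrite ltr_distlC; apply/andP; split; lra.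
  by rewrite ltNge Cr.
have T2s : T2 < s.
  rewrite ltNge; apply/negP => sT2; have := wc s; rewrite in_itv/= Ts sT2.
  move=> /(_ isT); move: Cs; rewrite /C ge_max => /andP[_]; lra.
have sC : w s <= C.
  rewrite leNgt; apply/negP => Cws.
  have [e /= e0 he] : \forall r \near s, C < w r.
    exact: (cvgr_gt _ (wcont s Ts)).
  pose r := Num.max T (s - e / 2).
  have rs : r < s by rewrite /r gt_max; apply/andP; split; lra.
  have sr : s - e / 2 <= r by rewrite /r le_max lexx orbT.
  have : w r < C by apply: ltC => //; rewrite /r le_max lexx.
  rewrite ltNge ltW//; apply: he => /=; rewrite ltr_distlC.
  by apply/andP; split; lra.
have wsE : w s = C by apply/le_anti; rewrite sC Cs.
have : 0 <= derive1 w s.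
  apply: (@left_max_derive1_ge0 _ _ T); [lra | exact: Tder |].
  by move=> r /andP[Tr rs]; rewrite wsE ltW// ltC// ltW.
rewrite leNgt Tdecr// wsE; first by rewrite /C le_max lexx.
have := Ttau s Ts; rewrite le_eqVlt => /predU1P[<-|tau0s].
  by rewrite subr0 wsE.
by apply/ltW/ltC; [exact/T2tau/ltW | lra].
Unshelve. all: by end_near. Qed.

(** * Exponential decay along the clock *)

(** Since [sigma t / t] tends to infinity, [S] grows more slowly than every
    positive multiple of [ln t], hence [expR (- mu * S t)] decays more slowly
    than [t^-1], and [sigma t * t^-1] tends to infinity. Quantitatively,
    [mu * S t - ln t] is eventually nonincreasing. *)
Lemma expR_slow_clock_gt (R : realType) (S sigma : R -> R) (mu K : R) :
    0 < mu -> 0 < K ->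
    (\forall t \near +oo, is_derive (t : R) 1 S (sigma t)^-1) ->
    sigma t / t @[t --> +oo] --> +oo ->
  \forall t \near +oo, K < expR (- (mu * S t)) * sigma t.
Proof.
move=> mu0 K0 Sder /cvgryPgt soo.
near (pinfty_nbhs R) => T.
have T0 : 0 < T by near: T; exact: nbhs_pinfty_gt.
have TS t : T <= t -> is_derive (t : R) 1 S (sigma t)^-1.
  by move: t; near: T; exact: near_pinfty_ge.
have Tsigma t : T <= t -> mu < sigma t / t.
  by move: t; near: T; apply: near_pinfty_ge; exact: soo.
pose f t := mu * S t - ln t.
have f_is t : T <= t -> is_derive (t : R) 1 f (mu * (sigma t)^-1 - t^-1).
  move=> Tt; have St := TS t Tt; have lnt := is_derive1_ln (lt_le_trans T0 Tt).
  exact: is_deriveB.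
have fT t : T <= t -> f t <= f T.
  move=> Tt; apply: (@ler0_derive1_nincry _ f T) => //.
  - by move=> s; rewrite in_itv/= andbT => /ltW/f_is[].
  - move=> s; rewrite in_itv/= andbT => /ltW Ts; have s0 := lt_le_trans T0 Ts.
    have [_] := f_is s Ts; rewrite -derive1E => ->.
    have := Tsigma s Ts; rewrite ltr_pdivlMr// => mus.
    have sigma0 : 0 < sigma s by apply: lt_trans mus; rewrite mulr_gt0.
    rewrite subr_le0 ler_pdivrMr// mulrC ler_pdivlMr//; exact: ltW.
  - apply: continuous_in_subspaceT => s; rewrite inE/= in_itv/= andbT => Ts.
    by apply/differentiable_continuous/derivable1_diffP; case: (f_is s Ts).
near=> t.
have Tt : T <= t by near: t; exact: nbhs_pinfty_ge.
have t0 := lt_le_trans T0 Tt.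
have Kt : K * expR (f T) < sigma t / t by near: t; exact: soo.
have sigma0 : 0 < sigma t.
  have := lt_trans mu0 (Tsigma t Tt); rewrite ltr_pdivlMr// mul0r; exact.
rewrite expRN mulrC ltr_pdivlMr ?expR_gt0//.
rewrite ltr_pdivlMr// in Kt; apply: le_lt_trans Kt.
rewrite -mulrA ler_pM2l// -[X in _ <= _ * X]lnK// -expRD ler_expR -lerBlDr.
exact: fT.
Unshelve. all: by end_near. Qed.

(** With [L = ln u], the function [u = expR (L)] solves
    [u' = p * (- a * u + b * u (t - tau t))] with [p >= u]. Along
    [u = expR (- mu * S)] the bracket is asymptotically
    [u * (b * expR mu - a)], negative for [mu < ln (a / b)] and positive for
    [mu > ln (a / b)]: these exponentials are super- and subsolutions, which
    the Razumikhin principle turns into bounds on [L + mu * S]. For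
    [mu > ln (a / b)] the sign alone suffices, as the exponential is
    decreasing. For [mu < ln (a / b)] the solution has to decay faster than the
    clock runs, that is [p * sigma] has to be large, and this is where
    [p >= u] and the slowness of the clock enter. *)
Lemma log_delay_decay (R : realType) (a b : R) (L S sigma p tau : R -> R) :
    0 < b -> b < a ->
    (\forall t \near +oo, is_derive (t : R) 1 S (sigma t)^-1) ->
    S t @[t --> +oo] --> +oo ->
    sigma t / t @[t --> +oo] --> +oo ->
    (\forall t \near +oo, 0 <= tau t) ->
    t - tau t @[t --> +oo] --> +oo ->
    S t - S (t - tau t) @[t --> +oo] --> (1 : R) ->
    (\forall t \near +oo, is_derive (t : R) 1 L
       (p t * (- a + b * expR (L (t - tau t) - L t)))) ->
    (\forall t \near +oo, expR (L t) <= p t) ->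
  L t / S t @[t --> +oo] --> - ln (a / b).
Proof.
move=> b0 ba Sder Soo soo tau0 tauoo S1 Lder Lp.
set lam := ln (a / b).
have a0 := lt_trans b0 ba.
have lam0 : 0 < lam by rewrite ln_gt0// ltr_pdivlMr// mul1r.
have bexp nu : b * expR nu = a * expR (nu - lam).
  rewrite expRB /lam lnK ?posrE ?divr_gt0//; field.
  by rewrite !gt_eqF.
have sigma0 : \forall t \near +oo, 0 < sigma t.
  near=> t; have t0 : 0 < t by near: t; exact: nbhs_pinfty_gt.
  have : 0 < sigma t / t by near: t; move/cvgryPgt : soo; exact.
  by rewrite ltr_pdivlMr// mul0r.
have w_is mu : \forall t \near +oo, is_derive (t : R) 1
    (fun t => L t + mu * S t)
    (p t * (- a + b * expR (L (t - tau t) - L t)) + mu * (sigma t)^-1).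
  near=> t.
  have Lt : is_derive (t : R) 1 L
    (p t * (- a + b * expR (L (t - tau t) - L t))) by near: t.
  have St : is_derive (t : R) 1 S (sigma t)^-1 by near: t.
  exact: is_deriveD.
have upper mu : 0 < mu < lam ->
    exists C, \forall t \near +oo, L t + mu * S t <= C.
  move=> /andP[mu0 mulam]; pose nu := (mu + lam) / 2.
  (* Over one delay the clock advances by almost 1, so that [mu] times this
     advance is below [nu], still smaller than [lam]. *)
  pose q := a - b * expR nu.
  have q0 : 0 < q.
    rewrite subr_gt0 bexp gtr_pMr// -expR0 ltr_expR /nu; lra.
  apply: (@razumikhin_bounded _ (fun t => L t + mu * S t) tau 0) => //.
    by apply: filterS (w_is mu) => t [].
  near=> t => w0 wtau.
  have [_ w'] : is_derive (t : R) 1 (fun t => L t + mu * S t)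
      (p t * (- a + b * expR (L (t - tau t) - L t)) + mu * (sigma t)^-1).
    by near: t; exact: w_is.
  rewrite derive1E w'.
  have st : 0 < sigma t by near: t.
  have Lpt : expR (L t) <= p t by near: t.
  have Snu : mu * (S t - S (t - tau t)) < nu.
    rewrite mulrC -ltr_pdivlMr//; near: t; apply: (cvgr_lt _ S1).
    by rewrite ltr_pdivlMr// /nu; lra.
  have q_le : - a + b * expR (L (t - tau t) - L t) <= - q.
    by rewrite /q opprB addrC lerD2r ler_pM2l// ler_expR; lra.
  have Kt : mu / q < expR (- (mu * S t)) * sigma t.
    by near: t; apply: expR_slow_clock_gt => //; rewrite divr_gt0.
  (* [w t >= 0] means [L t >= - mu * S t], hence
     [p t >= expR (- mu * S t)]. *)
  have pq : mu * (sigma t)^-1 < q * p t.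
    rewrite ltr_pdivrMr// -mulrA -ltr_pdivrMl// [ltLHS]mulrC.
    apply: (lt_le_trans Kt); rewrite ler_pM2r//.
    apply: le_trans Lpt; rewrite ler_expR; lra.
  have p0 : 0 <= p t by apply: le_trans Lpt; exact: expR_ge0.
  have := ler_wpM2l p0 q_le; lra.
have lower mu : lam < mu ->
    exists C, \forall t \near +oo, - (L t + mu * S t) <= C.
  move=> lammu; pose nu := (mu + lam) / 2.
  have mu0 := lt_trans lam0 lammu.
  have q0 : a < b * expR nu.
    by rewrite bexp ltr_pMr// -expR0 ltr_expR /nu; lra.
  apply: (@razumikhin_bounded _ (fun t => - (L t + mu * S t)) tau 0) => //.
    by apply: filterS (w_is mu) => t [wt _]; exact: derivableN.
  near=> t => w0; rewrite lerN2 => wtau.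
  have [wt w'] : is_derive (t : R) 1 (fun t => L t + mu * S t)
      (p t * (- a + b * expR (L (t - tau t) - L t)) + mu * (sigma t)^-1).
    by near: t; exact: w_is.
  rewrite derive1E deriveN// w' oppr_lt0.
  have st : 0 < sigma t by near: t.
  have Lpt : expR (L t) <= p t by near: t.
  have Snu : nu < mu * (S t - S (t - tau t)).
    rewrite [ltRHS]mulrC -ltr_pdivrMr//; near: t; apply: (cvgr_gt _ S1).
    by rewrite ltr_pdivrMr// /nu; lra.
  rewrite addr_gt0 ?mulr_gt0 ?invr_gt0//.
    by apply: lt_le_trans Lpt; exact: expR_gt0.
  rewrite addrC subr_gt0; apply: (lt_trans q0).
  by rewrite ltr_pM2l// ltr_expR; lra.
apply/cvgrPdist_le => eps eps0.
pose e := Num.min (eps / 2) (lam / 2).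
have e0 : 0 < e by rewrite lt_min; apply/andP; split; lra.
have e_eps : e <= eps / 2 by rewrite /e ge_min lexx.
have e_lam : e <= lam / 2 by rewrite /e ge_min lexx orbT.
have [C1 HC1] : exists C, \forall t \near +oo, L t + (lam - e) * S t <= C.
  by apply: upper; apply/andP; split; lra.
have [C2 HC2] : exists C, \forall t \near +oo, - (L t + (lam + e) * S t) <= C.
  by apply: lower; lra.
near=> t.
have S0 : 0 < S t by near: t; move/cvgryPgt : Soo; exact.
have SC1 : C1 / e <= S t by near: t; move/cvgryPge : Soo; exact.
have SC2 : C2 / e <= S t by near: t; move/cvgryPge : Soo; exact.
have H1 : L t + (lam - e) * S t <= C1 by near: t.
have H2 : - (L t + (lam + e) * S t) <= C2 by near: t.
rewrite ler_pdivrMr// in SC1; rewrite ler_pdivrMr// in SC2.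
have eS : e * S t <= eps / 2 * S t by rewrite ler_pM2r.
rewrite distrC opprK ler_norml; apply/andP; split.
  by rewrite -lerBlDr ler_pdivlMr//; lra.
by rewrite -lerBrDr ler_pdivrMr//; lra.
Unshelve. all: by end_near. Qed.

(** * The delay equation *)

Lemma taubar_ge0 (R : realType) (tau : R -> R) : 0 <= tau 0 -> 0 <= taubar tau.
Proof.
move=> tau0; rewrite oppr_ge0; set A := [set _ | _ in _].
have A0 : A (0 - tau 0) by exists 0 => //=.
have [Ainf|] := pselect (has_inf A); last by move=> /inf_out ->.
by apply: le_trans (ge_inf Ainf.2 A0) _; rewrite sub0r oppr_le0.
Qed.

Lemma within_cy_continuous (R : realType) (f : R -> R) (m t : R) :
  {within `[m, +oo[, continuous f} -> m < t -> {for t, continuous f}.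
Proof.
move=> /continuous_within_itvcyP[fcont _] mt.
by apply: fcont; rewrite in_itv/= mt.
Qed.

Theorem theorem9 (R : realType) (tau sigma g psi x : R -> R)
    (a b beta delta1 : R)
    (tau_cont : {within `[0, +oo[, continuous tau})
    (tau_ge0 : forall t : R, 0 <= t -> 0 <= tau t)
    (tau_lim : t - tau t @[t --> +oo] --> +oo)
    (sigma_cont : {within `[- taubar tau, +oo[, continuous sigma})
    (sigma_ge0 : forall t : R, - taubar tau <= t -> 0 <= sigma t)
    (sigma_int : forall u v : R, - taubar tau <= u -> u <= v ->
       lebesgue_measure.-integrable `[u, v] (inv_fun sigma))
    (sigma_int_oo : int_inv sigma 0 t @[t --> +oo] --> +oo)
    (sigma_oo : sigma t @[t --> +oo] --> +oo)
    (sigma_int_1 : int_inv sigma (t - tau t) t @[t --> +oo] --> (1 : R))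
    (sigma_div_oo : sigma t / t @[t --> +oo] --> +oo)
    (b_gt0 : 0 < b) (b_lt_a : b < a)
    (g_cont : {within `[0, +oo[, continuous g})
    (g_ge0 : forall y : R, 0 <= y -> 0 <= g y)
    (g0 : g 0 = 0)
    (g_gt0 : forall y : R, 0 < y -> 0 < g y)
    (delta1_gt0 : 0 < delta1)
    (g_derivable : {in `]0, delta1[, forall y : R, derivable g y 1})
    (g_C1 : {in `]0, delta1[, continuous (derive1 g)})
    (dg_gt0 : {in `]0, delta1[, forall y : R, 0 < derive1 g y})
    (beta_gt1 : 1 < beta)
    (dg_RV : RV0 (beta - 1) (derive1 g))
    (psi_cont : {within `[- taubar tau, 0], continuous psi})
    (psi_gt0 : forall t : R, - taubar tau <= t <= 0 -> 0 < psi t)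
    (x_sol : delay_solution a b g tau psi x)
    (x_lim : x t @[t --> +oo] --> (0 : R)) :
  let lim_g :=
    ln (g (x t)) / int_inv sigma 0 t @[t --> +oo] --> - ln (a / b) in
  let lim_x :=
    ln (x t) / int_inv sigma 0 t @[t --> +oo] --> - (beta^-1 * ln (a / b)) in
  [/\ lim_g, lim_g <-> lim_x & lim_x].
Proof.
move=> lim_g lim_x.
have [_ xpos _ xder _] := x_sol.
have m0 : - taubar tau <= 0 by rewrite oppr_le0 taubar_ge0// tau_ge0.
have x0 t : 0 <= t -> 0 < x t by move=> t0; apply/xpos/(le_trans m0).
have x_right : x t @[t --> +oo] --> 0^'+.
  apply: cvg_right0 => //; near=> t; apply: x0; near: t.
  exact: nbhs_pinfty_ge.
have g_right0 : g y @[y --> 0^'+] --> 0.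
  by move/continuous_within_itvcyP : g_cont => [_]; rewrite g0.
have g_diff : {in `]0, delta1[, continuous g}.
  by move=> y /g_derivable/derivable1_diffP/differentiable_continuous.
have g_RV := RV0_primitive delta1_gt0 g_right0 g_gt0 g_derivable dg_gt0 dg_RV.
have g_le_dg : \forall y \near 0^'+, g y < derive1 g y.
  by apply: (RV0_lt _ delta1_gt0 g_C1 g_diff dg_RV g_RV); lra.
have t_tau_ge0 : \forall t \near +oo, 0 <= t - tau t.
  by move/cvgryPge : tau_lim; exact.
have tau_near : \forall t \near +oo, 0 <= tau t.
  by near=> t; apply: tau_ge0; near: t; exact: nbhs_pinfty_ge.
pose S := int_inv sigma 0.
have S_der : \forall t \near +oo, is_derive (t : R) 1 S (sigma t)^-1.
  near (pinfty_nbhs R) => T.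
  have T0 : 0 <= T by near: T; exact: nbhs_pinfty_ge.
  have sigmaT t : T <= t -> 0 < sigma t.
    move: t; near: T; apply: near_pinfty_ge.
    by move/cvgryPgt : sigma_oo; exact.
  have contT t : T < t -> {for t, continuous sigma}.
    move=> Tt; apply: within_cy_continuous sigma_cont _.
    exact: le_lt_trans (le_trans m0 T0) Tt.
  near=> t; apply: (is_derive_int_inv sigma_int m0 T0 sigmaT contT).
  by near: t; exact: nbhs_pinfty_gt.
have S_delay : S t - S (t - tau t) @[t --> +oo] --> (1 : R).
  apply: cvg_near_eq sigma_int_1; near=> t.
  have tt0 : 0 <= t - tau t by near: t.
  rewrite /S (@int_inv_cat _ sigma (- taubar tau) 0 (t - tau t) t)//.
    by rewrite [RHS]addrC addKr.
  by rewrite gerBl; near: t.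
have x_near : \forall t \near +oo, x t \in `]0, delta1[.
  near=> t; rewrite in_itv/= x0/=; last by near: t; exact: nbhs_pinfty_ge.
  by near: t; exact: (cvgr_lt _ x_lim).
have L_der : \forall t \near +oo, is_derive (t : R) 1 (fun t => ln (g (x t)))
    (derive1 g (x t) *
     (- a + b * expR (ln (g (x (t - tau t))) - ln (g (x t))))).
  near=> t.
  have t0 : 0 < t by near: t; exact: nbhs_pinfty_gt.
  have xt : x t \in `]0, delta1[ by near: t.
  have gx0 : 0 < g (x t) by apply/g_gt0/x0/ltW.
  have gxtau0 : 0 < g (x (t - tau t)) by apply/g_gt0/x0; near: t.
  have xt_is := xder t t0.
  have g_is : is_derive (x t) 1 g (derive1 g (x t)).
    by apply: DeriveDef; [exact: g_derivable | rewrite derive1E].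
  have ln_is := is_derive1_ln gx0.
  have gx_is : is_derive t 1 (fun t => g (x t))
      (derive1 g (x t) * delay_rhs a b g tau x t) := is_derive1_comp g_is xt_is.
  have -> : derive1 g (x t) *
      (- a + b * expR (ln (g (x (t - tau t))) - ln (g (x t)))) =
      (g (x t))^-1 * (derive1 g (x t) * delay_rhs a b g tau x t).
    by rewrite expRB !lnK ?posrE// /delay_rhs; field; rewrite gt_eqF.
  exact: is_derive1_comp ln_is gx_is.
have lim_g_holds : lim_g.
  apply: (log_delay_decay b_gt0 b_lt_a S_der sigma_int_oo sigma_div_oo tau_near
    tau_lim S_delay L_der).
  near=> t; rewrite lnK ?posrE; last first.
    by apply/g_gt0/x0; near: t; exact: nbhs_pinfty_ge.
  by apply: ltW; near: t; exact: (x_right _ g_le_dg).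
have ratio : ln (g (x t)) / ln (x t) @[t --> +oo] --> beta.
  exact: cvg_comp x_right (RV0_ln_cvg delta1_gt0 g_diff g_RV).
have beta0 : 0 < beta by lra.
have lim_x_holds : lim_x.
  rewrite /lim_x mulrC -mulNr.
  apply: cvg_near_eq (cvgM lim_g_holds (cvgV (lt0r_neq0 beta0) ratio)).
  near=> t.
  have : 0 < ln (g (x t)) / ln (x t) by near: t; exact: (cvgr_gt _ ratio).
  move=> ratio0; have : ln (g (x t)) != 0.
    by apply: contraTneq ratio0 => ->; rewrite mul0r ltxx.
  by move=> lng0; rewrite /= invf_div mulrC mulrA divfK.
by split.
Unshelve. all: by end_near. Qed.
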